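(* Let $U_{AB}$ be a unitary and $F$ a concave, monotone increasing function. Suppose that, for every $\epsilon$, any $\epsilon$-correct (in diamond norm) implementation of $U_{AB}$ as a non-local quantum computation using a pure resource state $|\Psi\rangle_{LR}$ must have $S(R)_\Psi\ge\lambda-F(\epsilon)$. Then any $\epsilon$-correct implementation of $U_{AB}$ as a non-local quantum computation using a (possibly mixed) resource state $\Psi_{LR}$ must satisfy \[ E_f(L:R)_\Psi\ \ge\ \lambda-F\big(d_{AB}\sqrt{2\epsilon}\big). \]
   Context: A non-local quantum computation (NLQC) implementing a channel on $AB$ is a channel of the form $(\mathcal{W}_{K_aM_a\to A}\otimes\mathcal{W}'_{K_bM_b\to B})\circ(\mathcal{V}_{AL\to K_aM_b}\otimes\mathcal{V}'_{RB\to M_aK_b})(\cdot\otimes\Psi_{LR})$ with a shared resource state $\Psi_{LR}$ ($L$ Alice, $R$ Bob); it is an $\epsilon$-correct implementation of $U$ if its diamond norm distance (defined with $\|X\|_1=\mathrm{tr}|X|$) to $\rho\mapsto U\rho U^\dagger$ is at most $\epsilon$. $d_{AB}=\dim(\mathcal{H}_A\otimes\mathcal{H}_B)$, $S$ is the von Neumann entropy, and $E_f(L:R)_\rho=\min\sum_ip_iS(R)_{\psi_i}$ over ensembles $\{p_i,|\psi_i\rangle\}$ with $\rho=\sum_ip_i|\psi_i\rangle\langle\psi_i|$. *)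

(* Defs.v *)
From HB Require Import structures.
From mathcomp Require Import all_boot all_order all_algebra.
From mathcomp Require Import complex.
From mathcomp Require Import classical_sets reals exp.

Set Implicit Arguments.
Unset Strict Implicit.
Unset Printing Implicit Defensive.

Import Order.TTheory GRing.Theory Num.Theory.
Local Open Scope ring_scope.

Section QI.
Variable R : realType.
Local Notation C := R[i].

Definition creal (x : R) : C := Complex x 0.
Definition cconj (z : C) : C := conjc z.

(* An operator from H_J to H_I (a matrix with rows indexed by I, columns by J). *)
Definition op (I J : finType) := I -> J -> C.

Definition sop (I J : finType) := op I I -> op J J.

Definition opeq {I J : finType} (X Y : op I J) := forall i j, X i j = Y i j.
Definition mulop {I J K : finType} (X : op I J) (Y : op J K) : op I K :=
  fun i k => \sum_j X i j * Y j k.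
Definition adj {I J : finType} (X : op I J) : op J I := fun j i => cconj (X i j).
Definition addop {I J : finType} (X Y : op I J) : op I J := fun i j => X i j + Y i j.
Definition subop {I J : finType} (X Y : op I J) : op I J := fun i j => X i j - Y i j.
Definition idop (I : finType) : op I I := fun i j => (i == j)%:R.
Arguments idop I : clear implicits.
Definition diagop {I : finType} (d : I -> R) : op I I :=
  fun i j => (i == j)%:R * creal (d i).
Definition tens {I1 J1 I2 J2 : finType} (X : op I1 J1) (Y : op I2 J2)
  : op (I1 * I2)%type (J1 * J2)%type := fun i j => X i.1 j.1 * Y i.2 j.2.
Definition trace {I : finType} (X : op I I) : C := \sum_i X i i.
Definition ptrace1 {I J : finType} (X : op (I * J)%type (I * J)%type) : op J J :=
  fun j j' => \sum_i X (i, j) (i, j').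
Definition reindex {I J I' J' : finType} (f : I' -> I) (g : J' -> J) (X : op I J)
  : op I' J' := fun i j => X (f i) (g j).

Definition unitary {I : finType} (U : op I I) :=
  opeq (mulop (adj U) U) (idop I) /\ opeq (mulop U (adj U)) (idop I).

(* positive semidefinite: <v|X|v> >= 0 for all v (order of C: real and >= 0) *)
Definition psd {I : finType} (X : op I I) :=
  forall v : I -> C, 0 <= \sum_i \sum_j cconj (v i) * X i j * v j.
Definition density {I : finType} (rho : op I I) := psd rho /\ trace rho = 1.

Definition unit_vec {I : finType} (psi : I -> C) := \sum_i cconj (psi i) * psi i = 1.
Definition proj {I : finType} (psi : I -> C) : op I I := fun i j => psi i * cconj (psi j).

Definition is_spectrum {I : finType} (X : op I I) (d : {ffun I -> R}) :=
  exists U : op I I, unitary U /\ opeq X (mulop (mulop U (diagop d)) (adj U)).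
Definition eigvals {I : finType} (X : op I I) : {ffun I -> R} :=
  xget [ffun => 0] (is_spectrum X).

(* von Neumann entropy S(rho) = - tr rho ln rho (natural log, 0 ln 0 = 0) *)
Definition vn_entropy {I : finType} (rho : op I I) : R :=
  - \sum_i eigvals rho i * ln (eigvals rho i).

Definition trnorm {I J : finType} (X : op I J) : R :=
  \sum_j Num.sqrt (eigvals (mulop (adj X) X) j).

(* (Phi \otimes id_Ref)(Y) for a linear map Phi, computed blockwise *)
Definition ext_id {I J Ref : finType} (Phi : sop I J) : sop (I * Ref)%type (J * Ref)%type :=
  fun Y jr jr' => Phi (fun i i' => Y (i, jr.2) (i', jr'.2)) jr.1 jr'.1.

Definition diamond_norm {I J : finType} (Phi : sop I J) : R :=
  sup [set trnorm (@ext_id I J I Phi Y) | Y in [set Y : op (I * I)%type (I * I)%type | trnorm Y <= 1]].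

Definition sop_sub {I J : finType} (Phi Phi' : sop I J) : sop I J :=
  fun X => subop (Phi X) (Phi' X).

Definition kraus_apply {I J : finType} (Ks : seq (op J I)) : sop I J :=
  fun X j j' => \sum_(K <- Ks) mulop (mulop K X) (adj K) j j'.
Definition is_channel {I J : finType} (Ks : seq (op J I)) :=
  opeq (fun i i' => \sum_(K <- Ks) mulop (adj K) K i i') (idop I).
Definition kraus_tens {I1 J1 I2 J2 : finType} (Ks1 : seq (op J1 I1)) (Ks2 : seq (op J2 I2))
  : seq (op (J1 * J2)%type (I1 * I2)%type) := [seq tens K1 K2 | K1 <- Ks1, K2 <- Ks2].

Definition unitary_channel {I : finType} (U : op I I) : sop I I :=
  fun X => mulop (mulop U X) (adj U).

(* The non-local quantum computation
   (W_{KaMa->A} ⊗ W'_{KbMb->B}) ∘ (V_{AL->KaMb} ⊗ V'_{RB->MaKb}) (· ⊗ Psi_LR). *)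
Definition nlqc {A B L Rr Ka Ma Kb Mb : finType}
  (V : seq (op (Ka * Mb)%type (A * L)%type)) (V' : seq (op (Ma * Kb)%type (Rr * B)%type))
  (W : seq (op A (Ka * Ma)%type)) (W' : seq (op B (Kb * Mb)%type))
  (Psi : op (L * Rr)%type (L * Rr)%type) : sop (A * B)%type (A * B)%type :=
  fun X =>
    let Z := tens X Psi in
    let Z1 := reindex (fun x : ((A * L) * (Rr * B))%type => ((x.1.1, x.2.2), (x.1.2, x.2.1)))
                      (fun x : ((A * L) * (Rr * B))%type => ((x.1.1, x.2.2), (x.1.2, x.2.1))) Z in
    let Z2 := kraus_apply (kraus_tens V V') Z1 in
    let Z3 := reindex (fun y : ((Ka * Ma) * (Kb * Mb))%type => ((y.1.1, y.2.2), (y.1.2, y.2.1)))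
                      (fun y : ((Ka * Ma) * (Kb * Mb))%type => ((y.1.1, y.2.2), (y.1.2, y.2.1))) Z2 in
    kraus_apply (kraus_tens W W') Z3.

Definition eps_correct {I : finType} (N : sop I I) (U : op I I) (eps : R) :=
  diamond_norm (sop_sub N (unitary_channel U)) <= eps.

Definition nlqc_valid {A B L Rr Ka Ma Kb Mb : finType}
  (V : seq (op (Ka * Mb)%type (A * L)%type)) (V' : seq (op (Ma * Kb)%type (Rr * B)%type))
  (W : seq (op A (Ka * Ma)%type)) (W' : seq (op B (Kb * Mb)%type)) :=
  [/\ is_channel V, is_channel V', is_channel W & is_channel W'].

Definition ensemble {L Rr : finType} (rho : op (L * Rr)%type (L * Rr)%type)
  (n : nat) (p : 'I_n -> R) (psi : 'I_n -> (L * Rr)%type -> C) :=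
  [/\ forall k, 0 <= p k, \sum_k p k = 1, forall k, unit_vec (psi k) &
      opeq rho (fun x y => \sum_k creal (p k) * proj (psi k) x y)].

Definition ent_formation {L Rr : finType} (rho : op (L * Rr)%type (L * Rr)%type) : R :=
  inf [set s : R | exists n (p : 'I_n -> R) (psi : 'I_n -> (L * Rr)%type -> C),
         ensemble rho p psi /\ s = \sum_k p k * vn_entropy (ptrace1 (proj (psi k)))].

Definition concave_on_nonneg (F : R -> R) :=
  forall x y t, 0 <= x -> 0 <= y -> 0 <= t <= 1 ->
    t * F x + (1 - t) * F y <= F (t * x + (1 - t) * y).
Definition nondecr_on_nonneg (F : R -> R) :=
  forall x y, 0 <= x -> x <= y -> F x <= F y.

End QI.

(* Main.v *)
Require Import Defs.
From HB Require Import structures.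
From mathcomp Require Import all_boot all_order all_algebra.
From mathcomp Require Import complex.
From mathcomp Require Import classical_sets reals exp.
From mathcomp Require Import ring lra.
Import Order.TTheory GRing.Theory Num.Theory.
Local Open Scope ring_scope.

(* Decompose Psi = sum_k p_k |psi_k><psi_k| and apply the hypothesis to each psi_k
   with its own error e_k; by concavity and monotonicity of F it suffices that
   sum_k p_k e_k <= d sqrt(2 eps), where d = d_AB.  For any channel N with Choi
   fidelity f(N) to U one has
     2 (1 - f(N)) <= || N - U ||_diamond <= 2 d sqrt(1 - f(N)),
   and f is affine in N, hence
     sum_k p_k e_k <= 2 d sum_k p_k sqrt(1 - f(N_k)) <= 2 d sqrt(1 - f(N)) <= d sqrt(2 eps).
   The upper bound comes from comparing the Kraus operators K_a of N with c_a U,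
   c_a = tr(U^* K_a) / d, for which sum_a ||K_a - c_a U||_HS^2 = d (1 - f(N)).
   Trace norms are estimated by pairing with two Bessel families; the singular
   value decomposition makes the trace norm the best bound on such pairings. *)

(** * Inner products, Cauchy-Schwarz and Bessel families *)

Section Vectors.
Set Implicit Arguments.
Unset Strict Implicit.
Context {R : realType}.
Local Notation C := R[i].
Implicit Types (I J T : finType).

Definition absc (z : C) : R := ComplexField.Normc.normc z.

Lemma abscE (z : C) : creal (absc z) = `|z|.
Proof. by []. Qed.

Lemma creal_inj : injective (@creal R).
Proof. exact: complexI. Qed.

Lemma crealM (a b : R) : creal (a * b) = creal a * creal b.
Proof. exact: (rmorphM (real_complex R)). Qed.
Lemma crealB (a b : R) : creal (a - b) = creal a - creal b.
Proof. exact: (rmorphB (real_complex R)). Qed.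
Lemma crealN (a : R) : creal (- a) = - creal a.
Proof. exact: (rmorphN (real_complex R)). Qed.
Lemma crealX (a : R) n : creal (a ^+ n) = creal a ^+ n.
Proof. exact: (rmorphXn (real_complex R)). Qed.
Lemma creal0 : creal 0 = 0 :> C.
Proof. by []. Qed.
Lemma creal1 : creal 1 = 1 :> C.
Proof. by []. Qed.
Lemma creal_nat n : creal n%:R = n%:R :> C.
Proof. exact: (rmorph_nat (real_complex R)). Qed.
Lemma creal_sum T (P : pred T) (f : T -> R) :
  creal (\sum_(t | P t) f t) = \sum_(t | P t) creal (f t).
Proof. exact: (rmorph_sum (real_complex R)). Qed.

Lemma cconjM (a b : C) : cconj (a * b) = cconj a * cconj b.
Proof. exact: (rmorphM (@conjc R)). Qed.
Lemma cconjD (a b : C) : cconj (a + b) = cconj a + cconj b.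
Proof. exact: (rmorphD (@conjc R)). Qed.
Lemma cconjB (a b : C) : cconj (a - b) = cconj a - cconj b.
Proof. exact: (rmorphB (@conjc R)). Qed.
Lemma cconj_sum T (P : pred T) (f : T -> C) :
  cconj (\sum_(t | P t) f t) = \sum_(t | P t) cconj (f t).
Proof. exact: (rmorph_sum (@conjc R)). Qed.
Lemma cconjK (a : C) : cconj (cconj a) = a.
Proof. exact: conjcK. Qed.
Lemma cconj_creal (a : R) : cconj (creal a) = creal a.
Proof. exact: conjc_real. Qed.
Lemma cconj_nat n : cconj (n%:R : C) = n%:R.
Proof. exact: conjc_nat. Qed.

Lemma absc_ge0 (z : C) : 0 <= absc z.
Proof. by case: z => a b; exact: sqrtr_ge0. Qed.
Lemma abscM (a b : C) : absc (a * b) = absc a * absc b.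
Proof. exact: ComplexField.Normc.normcM. Qed.
Lemma abscD (a b : C) : absc (a + b) <= absc a + absc b.
Proof. exact: le_normcD. Qed.
Lemma absc_creal (a : R) : absc (creal a) = `|a|.
Proof. by rewrite /absc /= expr0n addr0 sqrtr_sqr. Qed.
Lemma absc_conj (z : C) : absc (cconj z) = absc z.
Proof. by case: z => a b; rewrite /absc /= sqrrN. Qed.
Lemma absc0 : absc 0 = 0.
Proof. by rewrite -creal0 absc_creal normr0. Qed.
Lemma absc_sum T (P : pred T) (f : T -> C) :
  absc (\sum_(t | P t) f t) <= \sum_(t | P t) absc (f t).
Proof.
elim/big_ind2: _ => [|x1 x2 y1 y2 h1 h2|t _]; rewrite ?absc0 //.
by apply: le_trans (abscD _ _) _; exact: lerD.
Qed.

Lemma absc_sqr (z : C) : creal (absc z ^+ 2) = cconj z * z.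
Proof. by rewrite crealX abscE sqr_normc mulrC. Qed.

Lemma absc_eq0 (z : C) : absc z = 0 -> z = 0.
Proof. exact: ComplexField.Normc.eq0_normc. Qed.

Definition ip {I} (u v : I -> C) : C := \sum_i cconj (u i) * v i.
Definition nsq {I} (u : I -> C) : R := \sum_i absc (u i) ^+ 2.

Lemma ip_nsq I (u : I -> C) : ip u u = creal (nsq u).
Proof. by rewrite creal_sum; apply: eq_bigr => i _; rewrite absc_sqr. Qed.

Lemma ip_conj I (u v : I -> C) : cconj (ip u v) = ip v u.
Proof.
rewrite cconj_sum; apply: eq_bigr => i _.
by rewrite cconjM cconjK mulrC.
Qed.

Lemma nsq_ge0 I (u : I -> C) : 0 <= nsq u.
Proof. by apply: sumr_ge0 => i _; exact: sqr_ge0. Qed.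

Lemma nsq_eq0 I (u : I -> C) i : nsq u = 0 -> u i = 0.
Proof.
move=> /eqP; rewrite psumr_eq0 => [/allP h|k _]; last exact: sqr_ge0.
by apply: absc_eq0; apply/eqP; have := h i (mem_index_enum _); rewrite sqrf_eq0.
Qed.

(** Lagrange's identity: the double sum of the squares [(a s * b t - a t * b s) ^+ 2] is twice the
    difference of the two sides. *)
Lemma cauchy_schwarz_real T (P : pred T) (a b : T -> R) :
  (\sum_(t | P t) a t * b t) ^+ 2 <= (\sum_(t | P t) a t ^+ 2) * (\sum_(t | P t) b t ^+ 2).
Proof.
have h : 0 <= \sum_(s | P s) \sum_(t | P t) (a s * b t - a t * b s) ^+ 2.
  by apply: sumr_ge0 => s _; apply: sumr_ge0 => t _; exact: sqr_ge0.
have e : \sum_(s | P s) \sum_(t | P t) (a s * b t - a t * b s) ^+ 2 =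
   (\sum_(t | P t) a t ^+ 2) * (\sum_(t | P t) b t ^+ 2)
   + (\sum_(t | P t) a t ^+ 2) * (\sum_(t | P t) b t ^+ 2)
   - 2 * (\sum_(t | P t) a t * b t) ^+ 2.
  rewrite [X in _ = _ + X - _]mulrC expr2 !big_distrlr /=.
  rewrite mulr_sumr -big_split -sumrB; apply: eq_bigr => s _.
  rewrite mulr_sumr -big_split -sumrB; apply: eq_bigr => t _ /=.
  by ring.
move: h; rewrite e; lra.
Qed.

Lemma absc_sum_mul_le T (P : pred T) (f g : T -> C) (p q : R) :
  0 <= p -> 0 <= q ->
  \sum_(t | P t) absc (f t) ^+ 2 <= p ^+ 2 -> \sum_(t | P t) absc (g t) ^+ 2 <= q ^+ 2 ->
  absc (\sum_(t | P t) f t * g t) <= p * q.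
Proof.
move=> p0 q0 hp hq; apply: le_trans (absc_sum _ _) _.
under eq_bigr do rewrite abscM.
rewrite -(@ler_pXn2r _ 2) ?nnegrE ?mulr_ge0 //; last first.
  by apply: sumr_ge0 => t _; rewrite mulr_ge0 ?absc_ge0.
apply: le_trans (cauchy_schwarz_real _ _ _) _.
by rewrite exprMn; apply: ler_pM => //; apply: sumr_ge0 => t _; exact: sqr_ge0.
Qed.

(** Bessel's inequality replaces orthonormality because it also admits zero vectors, which arise
    from vanishing singular values. *)
Definition bessel {T I} (x : T -> I -> C) :=
  forall w, \sum_t absc (ip (x t) w) ^+ 2 <= nsq w.

(** Testing the inequality on [w = x t] bounds the square of [nsq (x t)] by [nsq (x t)] itself. *)
Lemma bessel_nsq T I (x : T -> I -> C) t : bessel x -> nsq (x t) <= 1.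
Proof.
move=> /(_ (x t)); rewrite (bigD1 t) //= ip_nsq absc_creal.
rewrite ger0_norm ?nsq_ge0 // => h.
have {}h : nsq (x t) ^+ 2 <= nsq (x t).
  by apply: le_trans h; rewrite lerDl; apply: sumr_ge0 => s _; exact: sqr_ge0.
have := nsq_ge0 (x t); nra.
Qed.

Lemma ip_sumr T I (c : T -> C) (x : T -> I -> C) (u : I -> C) :
  ip u (fun i => \sum_t c t * x t i) = \sum_t c t * ip u (x t).
Proof.
rewrite /ip; under eq_bigr do rewrite mulr_sumr.
rewrite exchange_big; apply: eq_bigr => t _; rewrite mulr_sumr.
by apply: eq_bigr => i _; rewrite mulrCA.
Qed.

Lemma ip_subr I (u v w : I -> C) : ip u (fun i => v i - w i) = ip u v - ip u w.
Proof. by rewrite /ip -sumrB; apply: eq_bigr => i _; rewrite mulrBr. Qed.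

Lemma ip_subl I (u v w : I -> C) : ip (fun i => v i - w i) u = ip v u - ip w u.
Proof. by rewrite -ip_conj ip_subr cconjB !ip_conj. Qed.

(** Expand the squared norm of [w - p], where [p] combines the [x t] with coefficients [ip (x t) w],
    and use that it is nonnegative. The squared norms [e t] need only be at most 1, so zero vectors
    are covered. *)
Lemma orthogonal_bessel T I (x : T -> I -> C) (e : T -> R) :
  (forall t, e t <= 1) ->
  (forall s t, ip (x s) (x t) = (s == t)%:R * creal (e s)) -> bessel x.
Proof.
move=> e1 xx w.
pose c t := ip (x t) w.
pose p i := \sum_t c t * x t i.
have pw : ip w p = \sum_t creal (absc (c t) ^+ 2).
  by rewrite ip_sumr; apply: eq_bigr => t _; rewrite -(ip_conj (x t)) absc_sqr mulrC.
have wp : ip p w = \sum_t creal (absc (c t) ^+ 2).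
  by rewrite -ip_conj pw cconj_sum; apply: eq_bigr => t _; rewrite cconj_creal.
have pp : ip p p = \sum_t creal (absc (c t) ^+ 2 * e t).
  rewrite ip_sumr; apply: eq_bigr => t _.
  rewrite -ip_conj ip_sumr (bigD1 t) //= big1 => [|s st].
    by rewrite addr0 xx eqxx mul1r cconjM cconj_creal crealM absc_sqr mulrCA mulrA.
  by rewrite xx eq_sym (negPf st) mul0r mulr0.
have := nsq_ge0 (fun i => w i - p i).
have := ip_nsq (fun i => w i - p i).
rewrite ip_subl !ip_subr pw wp pp ip_nsq -!creal_sum -!crealB => /creal_inj <-.
have : \sum_t absc (c t) ^+ 2 * e t <= \sum_t absc (c t) ^+ 2.
  by apply: ler_sum => t _; rewrite ler_piMr ?sqr_ge0.
by rewrite -/c; lra.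
Qed.

End Vectors.

(** * Spectral theorem, singular values and duality for the trace norm *)

Section Spectral.
Set Implicit Arguments.
Unset Strict Implicit.
Context {R : realType}.
Local Notation C := R[i].
Implicit Types (I J T : finType).

Lemma cconjE (z : C) : z^* = cconj z.
Proof.
have [->|z0] := eqVneq z 0; first by rewrite rmorph0 /cconj conjc0.
by apply: (mulfI z0); rewrite -normCK sqr_normc.
Qed.

Lemma sum_deltal I (i : I) (f : I -> C) : \sum_j (i == j)%:R * f j = f i.
Proof.
rewrite (bigD1 i) //= eqxx mul1r big1 ?addr0 // => j ji.
by rewrite eq_sym (negPf ji) mul0r.
Qed.

Lemma sum_deltar I (i : I) (f : I -> C) : \sum_j f j * (j == i)%:R = f i.
Proof.
by rewrite -[RHS]sum_deltal; apply: eq_bigr => j _; rewrite mulrC eq_sym.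
Qed.

Lemma spectral_formE I (U : op R I I) (d : I -> R) i k :
  mulop (mulop U (diagop d)) (adj U) i k =
  \sum_j creal (d j) * (U i j * cconj (U k j)).
Proof.
apply: eq_bigr => j _; rewrite /mulop /diagop /adj.
have -> : \sum_l U i l * ((l == j)%:R * creal (d l)) = creal (d j) * U i j.
  rewrite -(sum_deltar j (fun l => creal (d l) * U i l)).
  by apply: eq_bigr => l _; rewrite mulrC -!mulrA [creal _ * _]mulrC mulrA mulrC -mulrA.
by rewrite mulrA.
Qed.

(** Enumerating [I] turns the operator into a matrix, to which the spectral theorem for normal
    matrices applies; its eigenvalues are real by Hermiticity. *)
Lemma hermitian_spectrum I (X : op R I I) :
  (forall i j, X i j = cconj (X j i)) -> exists d, is_spectrum X d.
Proof.
move=> hX.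
pose M : 'M[C]_#|I| := \matrix_(a, b) X (enum_val a) (enum_val b).
have hM : M \is hermsymmx.
  apply/is_hermitianmxP; rewrite expr0 scale1r.
  by apply/matrixP => a b; rewrite !mxE cconjE; exact: hX.
have /hermitian_normalmx/orthomx_spectralP eM := hM.
have /mxOverP rd := hermitian_spectral_diag_real hM.
set P := spectralmx M in eM; set sp := spectral_diag M in eM rd.
have uP : P \is unitarymx := spectral_unitarymx M.
rewrite invmx_unitary // in eM.
have uP' : map_mx Num.conj P^T *m P = 1%:M.
  by rewrite -invmx_unitary // mulVmx // spectral_unit.
move/unitarymxP in uP.
exists [ffun i => complex.Re (sp 0 (enum_rank i))].
(* The matrix factors as [P^* D P], so the diagonalizing unitary is the adjoint of [P]. *)
exists (fun i j => cconj (P (enum_rank j) (enum_rank i))); split; [split|].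
- move=> i j; rewrite /mulop /adj /idop.
  have /matrixP/(_ (enum_rank i) (enum_rank j)) := uP.
  rewrite !mxE (inj_eq enum_rank_inj) => <-.
  rewrite (reindex (@enum_val I I)) /=; last exact/onW_bij/enum_val_bij.
  by apply: eq_bigr => a _; rewrite enum_valK !mxE cconjE cconjK.
- move=> i j; rewrite /mulop /adj /idop.
  have /matrixP/(_ (enum_rank i) (enum_rank j)) := uP'.
  rewrite !mxE (inj_eq enum_rank_inj) => <-.
  rewrite (reindex (@enum_val I I)) /=; last exact/onW_bij/enum_val_bij.
  by apply: eq_bigr => a _; rewrite enum_valK !mxE cconjE cconjK.
- move=> i j; rewrite spectral_formE.
  have /matrixP/(_ (enum_rank i) (enum_rank j)) := eM.
  rewrite {1}mxE !enum_rankK => ->.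
  rewrite mul_mx_diag !mxE (reindex (@enum_val I I)) /=; last exact/onW_bij/enum_val_bij.
  apply: eq_bigr => a _; rewrite enum_valK ffunE cconjK !mxE cconjE enum_valK.
  by rewrite [creal _](RRe_real (rd _ _)); ring.
Qed.

(** [eigvals] chooses a spectrum and falls back on 0 if there is none; a Hermitian operator has one
    to choose. *)
Lemma eigvals_spectrum I (X : op R I I) :
  (forall i j, X i j = cconj (X j i)) -> is_spectrum X (eigvals X).
Proof. by move=> /hermitian_spectrum hX; exact: (@xgetPex _ [ffun=> 0] (is_spectrum X) hX). Qed.

(** The trace of [Z] against the sum of the operators [|y_t><x_t|]. For Bessel families that sum is
    a contraction, so this is the pairing between trace norm and operator norm. *)
Definition pairing {T I J} (x : T -> I -> C) (Z : op R I J) (y : T -> J -> C) : C :=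
  \sum_t \sum_i \sum_j cconj (x t i) * Z i j * y t j.

(** The [y j] are eigenvectors of [X^* X], the [s j] are square roots of its eigenvalues, and [x j]
    is [X (y j)] divided by [s j]. *)
Lemma svd I J (X : op R I J) : exists (s : J -> R) (x : J -> I -> C) (y : J -> J -> C),
  [/\ bessel x, bessel y & forall j, 0 <= s j] /\
  [/\ trnorm X = \sum_j s j,
     forall i k, X i k = \sum_j creal (s j) * (x j i * cconj (y j k)) &
     pairing x X y = creal (trnorm X)].
Proof.
pose G := mulop (adj X) X.
have hG i j : G i j = cconj (G j i).
  by rewrite cconj_sum; apply: eq_bigr => k _; rewrite /adj cconjM cconjK mulrC.
have [U [[U1 U2] GU]] := eigvals_spectrum hG.
set d := eigvals _ in GU.
pose y j k := U k j.
pose v j i := \sum_k y j k * X i k.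
have vv j l : ip (v j) (v l) = (j == l)%:R * creal (d l).
  have -> : ip (v j) (v l) = \sum_k \sum_m cconj (y j k) * G k m * y l m.
    rewrite /ip; under eq_bigr do rewrite cconj_sum big_distrlr /=.
    rewrite exchange_big; apply: eq_bigr => k _; rewrite exchange_big.
    apply: eq_bigr => m _; rewrite /G /mulop /adj mulr_sumr mulr_suml.
    by apply: eq_bigr => i _; rewrite cconjM; ring.
  have UU a b : \sum_k cconj (U k a) * U k b = (a == b)%:R by exact: U1.
  transitivity (\sum_a creal (d a) * ((\sum_k cconj (U k j) * U k a) * (\sum_m cconj (U m a) * U m l))).
    under eq_bigr => k _ do under eq_bigr => m _ do
      rewrite GU spectral_formE mulr_sumr mulr_suml.
    under eq_bigr do rewrite exchange_big.
    rewrite exchange_big; apply: eq_bigr => a _ /=.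
    rewrite big_distrlr mulr_sumr; apply: eq_bigr => k _ /=.
    by rewrite mulr_sumr; apply: eq_bigr => m _; rewrite /y; ring.
  under eq_bigr do rewrite !UU mulrCA.
  by rewrite (sum_deltal j (fun a => creal (d a) * (a == l)%:R)) mulrC; case: eqP => [->|_]; rewrite ?mul0r.
have dE j : d j = nsq (v j).
  by apply: creal_inj; rewrite -ip_nsq vv eqxx mul1r.
have d0 j : 0 <= d j by rewrite dE nsq_ge0.
pose s j := Num.sqrt (d j).
have s0 j : 0 <= s j by exact: sqrtr_ge0.
have s2 j : s j * s j = d j by rewrite -expr2 sqr_sqrtr.
(* As [0^-1 = 0], a zero singular value gives the zero vector here, so [x] is Bessel but in general
   not orthonormal. *)
pose x j i := creal ((s j)^-1) * v j i.
exists s, x, y; split; split => //.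
- apply: (@orthogonal_bessel _ _ _ _ (fun j => ((s j)^-1 * s j) ^+ 2)).
    move=> t; have [->|st] := eqVneq (s t) 0; first by rewrite mulr0 expr0n.
    by rewrite mulVf // expr1n.
  move=> a b; transitivity (creal ((s a)^-1) * creal ((s b)^-1) * ip (v a) (v b)).
    rewrite /ip mulr_sumr; apply: eq_bigr => i _.
    by rewrite /x cconjM cconj_creal; ring.
  rewrite vv; case: eqP => [->|_]; rewrite ?mul0r ?mulr0 // !mul1r -!crealM.
  by congr creal; rewrite -s2; ring.
- by apply: (@orthogonal_bessel _ _ _ _ (fun=> 1)) => // a b; rewrite mulr1; exact: U1.
(* Completeness of the eigenbasis writes [X] as the sum of [|v_j><y_j|]; if [s j] vanishes, so does
   [v j]. *)
- move=> i k; have -> : X i k = \sum_j v j i * cconj (y j k).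
    rewrite -(sum_deltar k (fun m => X i m)).
    under eq_bigr => m _ do rewrite -[(_ == _)%:R](U2 m k) mulr_sumr.
    rewrite exchange_big; apply: eq_bigr => j _; rewrite /v mulr_suml.
    by apply: eq_bigr => m _; rewrite /adj /y; ring.
  apply: eq_bigr => j _; rewrite /x !mulrA -crealM.
  have [sj|sj] := eqVneq (s j) 0; last by rewrite mulfV // mul1r.
  by rewrite (nsq_eq0 (u := v j)) ?mulr0 // -dE -s2 sj mulr0.
- rewrite /trnorm creal_sum; apply: eq_bigr => j _.
  transitivity (creal ((s j)^-1) * ip (v j) (v j)).
    rewrite /ip mulr_sumr; apply: eq_bigr => i _.
    rewrite {2}/v !mulr_sumr; apply: eq_bigr => k _.
    by rewrite /x cconjM cconj_creal; ring.
  rewrite vv eqxx mul1r -crealM; congr creal; rewrite -[Num.sqrt _]/(s j) -s2.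
  by have [->|sj] := eqVneq (s j) 0; rewrite ?mulr0 // mulKf.
Qed.

(** Dual form of the bound [trnorm Z <= b]. It is visibly subadditive in [Z], whereas eigenvalues of
    [Z^* Z] are not easily compared under sums. *)
Definition pairing_le {I J} (Z : op R I J) (b : R) :=
  forall (T : finType) (x : T -> I -> C) (y : T -> J -> C),
  bessel x -> bessel y -> absc (pairing x Z y) <= b.

(** The singular vectors attain the trace norm. *)
Lemma trnorm_le I J (X : op R I J) b : pairing_le X b -> trnorm X <= b.
Proof.
have [s [x [y [[bx by_ s0] [_ _ e]]]]] := svd X.
move=> /(_ _ _ _ bx by_); rewrite e absc_creal; apply: le_trans; exact: ler_norm.
Qed.

Lemma pairing_sum (S : finType) T I J (P : pred S)
    (x : T -> I -> C) (y : T -> J -> C) (c : S -> C) (Z : S -> op R I J) :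
  pairing x (fun i j => \sum_(a | P a) c a * Z a i j) y = \sum_(a | P a) c a * pairing x (Z a) y.
Proof.
rewrite /pairing; under [RHS]eq_bigr do rewrite mulr_sumr.
rewrite [RHS]exchange_big; apply: eq_bigr => t _ /=.
under [RHS]eq_bigr do rewrite mulr_sumr.
rewrite [RHS]exchange_big; apply: eq_bigr => i _ /=.
under [RHS]eq_bigr do rewrite mulr_sumr.
rewrite [RHS]exchange_big; apply: eq_bigr => j _ /=.
rewrite mulr_sumr mulr_suml; apply: eq_bigr => a _; ring.
Qed.

Lemma eq_pairing T I J (x : T -> I -> C) (y : T -> J -> C) (Z Z' : op R I J) :
  opeq Z Z' -> pairing x Z y = pairing x Z' y.
Proof.
by move=> e; apply: eq_bigr => t _; apply: eq_bigr => i _; apply: eq_bigr => j _; rewrite e.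
Qed.

Lemma pairing_rank1 T I J (x : T -> I -> C) (y : T -> J -> C) (u : I -> C) (v : J -> C) :
  pairing x (fun i j => u i * cconj (v j)) y = \sum_t ip (x t) u * cconj (ip (y t) v).
Proof.
apply: eq_bigr => t _; rewrite ip_conj /ip big_distrlr; apply: eq_bigr => i _ /=.
by apply: eq_bigr => j _; ring.
Qed.

(** Expand [X] in singular vectors: each rank-one term pairs to at most 1 by Cauchy-Schwarz and the
    two Bessel inequalities. *)
Lemma pairing_le_trnorm I J (X : op R I J) : pairing_le X (trnorm X).
Proof.
have [s [a [b [[ba bb s0] [-> eX _]]]]] := svd X.
move=> T x y bx by_; rewrite (eq_pairing _ _ eX) pairing_sum.
apply: le_trans (absc_sum _ _) _; apply: ler_sum => j _.
rewrite abscM absc_creal ger0_norm // ler_piMr //.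
rewrite pairing_rank1 -[1](mulr1 1); apply: absc_sum_mul_le => //; rewrite expr1n.
  by apply: le_trans (bx _) _; exact: bessel_nsq.
by under eq_bigr do rewrite absc_conj; apply: le_trans (by_ _) _; exact: bessel_nsq.
Qed.

End Spectral.

(** * Two-sided Kraus maps and their trace-norm bounds *)

Section KrausMaps.
Set Implicit Arguments.
Unset Strict Implicit.
Context {R : realType}.
Local Notation C := R[i].
Implicit Types (I J T : finType).

(** The left and right families may differ, so that the cross terms in a difference of two channels
    are of this form too. *)
Definition kraus_map {I J T} (P Q : T -> op R J I) : sop R I J :=
  fun X j j' => \sum_a \sum_i \sum_i' P a j i * X i i' * cconj (Q a j' i').

Definition kraus_isometry {I J T} (K : T -> op R J I) :=
  forall i i', \sum_a \sum_j cconj (K a j i) * K a j i' = (i == i')%:R.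

(** For [0 <= p]: the stacked operator sending [u] to the family of all [P a u] has operator norm at
    most [p]. *)
Definition op_bound {I J T} (P : T -> op R J I) (p : R) :=
  forall u : I -> C, \sum_a nsq (fun j => \sum_i P a j i * u i) <= p ^+ 2 * nsq u.

(** The operator norm is at most the Hilbert-Schmidt norm, by Cauchy-Schwarz in every row. *)
Lemma op_bound_hs I J T (P : T -> op R J I) p :
  \sum_a \sum_j \sum_i absc (P a j i) ^+ 2 <= p ^+ 2 -> op_bound P p.
Proof.
move=> hp u; apply: le_trans (ler_wpM2r (nsq_ge0 u) hp).
rewrite mulr_suml; apply: ler_sum => a _; rewrite mulr_suml; apply: ler_sum => j _.
apply: le_trans (cauchy_schwarz_real _ _ _).
rewrite ler_pXn2r ?nnegrE ?absc_ge0 //; last first.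
  by apply: sumr_ge0 => i _; rewrite mulr_ge0 ?absc_ge0.
by apply: le_trans (absc_sum _ _) _; under eq_bigr do rewrite abscM.
Qed.

Lemma op_bound_isometry I J T (K : T -> op R J I) : kraus_isometry K -> op_bound K 1.
Proof.
move=> hK u; rewrite expr1n mul1r.
suff -> : \sum_a nsq (fun j => \sum_i K a j i * u i) = nsq u by [].
apply: creal_inj; rewrite -ip_nsq creal_sum.
transitivity (\sum_i \sum_i' cconj (u i) * ((\sum_a \sum_j cconj (K a j i) * K a j i') * u i')).
  under eq_bigr do rewrite -ip_nsq.
  under [RHS]eq_bigr => i _ do under eq_bigr => i' _ do rewrite mulr_suml mulr_sumr.
  under [RHS]eq_bigr do rewrite exchange_big.
  rewrite [RHS]exchange_big; apply: eq_bigr => a _ /=.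
  under [RHS]eq_bigr => i _ do under eq_bigr => i' _ do rewrite mulr_suml mulr_sumr.
  under [RHS]eq_bigr do rewrite exchange_big.
  rewrite [RHS]exchange_big; apply: eq_bigr => j _ /=.
  rewrite cconj_sum big_distrlr; apply: eq_bigr => i _; apply: eq_bigr => i' _ /=.
  by rewrite cconjM; ring.
apply: eq_bigr => i _; under eq_bigr do rewrite hK.
by rewrite -mulr_sumr sum_deltal.
Qed.

Definition apply_ref {I J Ref : finType} (P : op R J I) (u : I * Ref -> C) (m : J * Ref) : C :=
  \sum_i P m.1 i * u (i, m.2).

Lemma nsq_pair I J (u : I * J -> C) : nsq u = \sum_j nsq (fun i => u (i, j)).
Proof.
rewrite exchange_big /nsq pair_bigA /=.
by apply: eq_bigr => -[].
Qed.

(** The operators act separately on each slice of [u] with fixed reference index, so a reference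
    system does not worsen the bound. *)
Lemma op_bound_ref I J T (Ref : finType) (P : T -> op R J I) p (u : I * Ref -> C) :
  op_bound P p -> \sum_a nsq (apply_ref (P a) u) <= p ^+ 2 * nsq u.
Proof.
move=> hP; under eq_bigr do rewrite nsq_pair.
rewrite exchange_big nsq_pair mulr_sumr; apply: ler_sum => r _.
exact: (hP (fun i => u (i, r))).
Qed.

(** The singular value decomposition of [Y] reduces to rank-one inputs. For these, Cauchy-Schwarz
    over the pairs [(a, t)] separates the families: Bessel sums out [t], and the operator bound sums
    out [a]. *)
Lemma pairing_le_kraus I J T (Ref : finType) (P Q : T -> op R J I) p q
    (Y : op R (I * Ref)%type (I * Ref)%type) :
  0 <= p -> 0 <= q -> op_bound P p -> op_bound Q q ->
  pairing_le (ext_id (kraus_map P Q) Y) (p * q * trnorm Y).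
Proof.
move=> p0 q0 hP hQ S x y bx by_.
have [s [u [v [[bu bv s0] [-> eY _]]]]] := svd Y.
have e : opeq (ext_id (kraus_map P Q) Y) (fun m n => \sum_l creal (s l) *
    (\sum_a 1 * (apply_ref (P a) (u l) m * cconj (apply_ref (Q a) (v l) n)))).
  move=> m n; rewrite /ext_id /kraus_map.
  under [RHS]eq_bigr do rewrite mulr_sumr.
  rewrite [RHS]exchange_big; apply: eq_bigr => a _ /=.
  under [RHS]eq_bigr do rewrite mul1r /apply_ref cconj_sum big_distrlr mulr_sumr.
  rewrite [RHS]exchange_big; apply: eq_bigr => i _ /=.
  under [RHS]eq_bigr do rewrite mulr_sumr.
  rewrite [RHS]exchange_big; apply: eq_bigr => i' _ /=.
  rewrite eY mulr_sumr mulr_suml; apply: eq_bigr => l _.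
  by rewrite cconjM; ring.
rewrite (eq_pairing _ _ e) pairing_sum mulr_sumr.
apply: le_trans (absc_sum _ _) _; apply: ler_sum => l _.
rewrite abscM absc_creal ger0_norm // mulrC ler_wpM2r //.
rewrite pairing_sum; under eq_bigr do rewrite mul1r pairing_rank1.
rewrite pair_bigA /=; apply: absc_sum_mul_le => //.
  rewrite -(pair_bigA _ (fun a t => absc (ip (x t) (apply_ref (P a) (u l))) ^+ 2)) /=.
  apply: le_trans (_ : _ <= \sum_a nsq (apply_ref (P a) (u l))) _.
    by apply: ler_sum => a _; exact: bx.
  apply: le_trans (op_bound_ref _ hP) _.
  by rewrite ler_piMr ?sqr_ge0 // bessel_nsq.
under eq_bigr do rewrite absc_conj.
rewrite -(pair_bigA _ (fun a t => absc (ip (y t) (apply_ref (Q a) (v l))) ^+ 2)) /=.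
apply: le_trans (_ : _ <= \sum_a nsq (apply_ref (Q a) (v l))) _.
  by apply: ler_sum => a _; exact: by_.
apply: le_trans (op_bound_ref _ hQ) _.
by rewrite ler_piMr ?sqr_ge0 // bessel_nsq.
Qed.

Lemma pairing_leD I J (Z Z' : op R I J) b b' :
  pairing_le Z b -> pairing_le Z' b' -> pairing_le (addop Z Z') (b + b').
Proof.
move=> h h' T x y bx by_.
have -> : pairing x (addop Z Z') y = pairing x Z y + pairing x Z' y.
  rewrite /pairing -big_split; apply: eq_bigr => t _ /=.
  rewrite -big_split; apply: eq_bigr => i _ /=.
  by rewrite -big_split; apply: eq_bigr => j _ /=; rewrite /addop; ring.
by apply: le_trans (abscD _ _) _; apply: lerD; [exact: h | exact: h'].
Qed.

Lemma eq_pairing_le I J (Z Z' : op R I J) b :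
  opeq Z Z' -> pairing_le Z' b -> pairing_le Z b.
Proof. by move=> e h T x y bx by_; rewrite (eq_pairing _ _ e); exact: h. Qed.

(** Pair [X] with the standard basis [e] and its image [y] under the reflection [1 - 2 |phi><phi|];
    both are orthonormal, hence Bessel. *)
Lemma trace_reflection_le I (X : op R I I) (phi : I -> C) :
  unit_vec phi ->
  absc (trace X - 2 * \sum_i \sum_j cconj (phi i) * X i j * phi j) <= trnorm X.
Proof.
move=> phi1.
pose e (m : I) (i : I) : C := (m == i)%:R.
pose y (m : I) (i : I) : C := (i == m)%:R - 2 * phi i * cconj (phi m).
have be : bessel e.
  move=> w; rewrite /ip; under eq_bigr => m _.
    by under eq_bigr do rewrite cconj_nat; rewrite sum_deltal; over.
  by [].
have by_ : bessel y.
  apply: (@orthogonal_bessel _ _ _ _ (fun=> 1)) => // s t; rewrite mulr1 /ip.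
  transitivity (\sum_i (s == i)%:R * ((i == t)%:R - 2 * phi i * cconj (phi t))
     - 2 * phi s * (\sum_i cconj (phi i) * (i == t)%:R
     - 2 * cconj (phi t) * \sum_i cconj (phi i) * phi i)).
    rewrite [in RHS]mulr_sumr -sumrB mulr_sumr -sumrB; apply: eq_bigr => i _.
    rewrite /y cconjB !cconjM cconjK !cconj_nat eq_sym; ring.
  by rewrite phi1 sum_deltal sum_deltar; ring.
have := pairing_le_trnorm X be by_; apply: le_trans.
rewrite le_eqVlt; apply/orP; left; apply/eqP; congr absc.
rewrite /trace mulr_sumr -sumrB; apply: eq_bigr => m _.
under [RHS]eq_bigr => i _.
  by under eq_bigr do rewrite cconj_nat -mulrA; rewrite -mulr_sumr; over.
rewrite sum_deltal -[X in X - _](sum_deltar m) mulr_sumr -sumrB.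
by apply: eq_bigr => j _; rewrite /y; ring.
Qed.

Lemma trnorm_proj_le1 I (phi : I -> C) : unit_vec phi -> trnorm (proj phi) <= 1.
Proof.
rewrite /unit_vec -[X in X = _]/(ip phi phi) ip_nsq => /creal_inj n1.
apply: trnorm_le => T x y bx by_.
rewrite pairing_rank1 -[1](mulr1 1); apply: absc_sum_mul_le => //; rewrite expr1n -n1.
  exact: bx.
by under eq_bigr do rewrite absc_conj; exact: by_.
Qed.

End KrausMaps.

(** * Diamond distance between a channel and a unitary one, in terms of fidelity *)

Section DiamondDistance.
Set Implicit Arguments.
Unset Strict Implicit.
Context {R : realType}.
Local Notation C := R[i].
Context {I T : finType} (U : op R I I) (K : T -> op R I I).
Hypothesis unitaryU : unitary U.
Hypothesis isometryK : kraus_isometry K.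
Hypothesis I_gt0 : (0 < #|I|)%N.
Let d : R := #|I|%:R.

Definition overlap (X : op R I I) : C := \sum_j \sum_i cconj (U j i) * X j i.
(** The entanglement fidelity, i.e. the overlap of the Choi states of the channel and of [U]. *)
Definition fidelity : R := (\sum_a absc (overlap (K a)) ^+ 2) / d ^+ 2.

Let d_gt0 : 0 < d.
Proof. by rewrite ltr0n. Qed.
Let dE : creal d = #|I|%:R.
Proof. exact: creal_nat. Qed.

Lemma isometry_hs : \sum_a \sum_j \sum_i absc (K a j i) ^+ 2 = d.
Proof.
apply: creal_inj; rewrite dE creal_sum.
under eq_bigr => a _.
  rewrite creal_sum; under eq_bigr => j _.
    by rewrite creal_sum; under eq_bigr do rewrite absc_sqr; over.
  by rewrite exchange_big; over.
rewrite exchange_big /= -sum1_card natr_sum.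
by apply: eq_bigr => i _; rewrite isometryK eqxx.
Qed.

Lemma unitary_hs : \sum_j \sum_i absc (U j i) ^+ 2 = d.
Proof.
apply: creal_inj; rewrite dE exchange_big /= creal_sum -sum1_card natr_sum.
apply: eq_bigr => i _; rewrite creal_sum; under eq_bigr do rewrite absc_sqr.
by have [/(_ i i) + _] := unitaryU; rewrite /idop eqxx.
Qed.

Let c a : C := creal (d^-1) * overlap (K a).
Let D a : op R I I := fun j i => K a j i - c a * U j i.

Let sum_c : \sum_a absc (c a) ^+ 2 = fidelity.
Proof.
rewrite /fidelity mulr_suml; apply: eq_bigr => a _.
rewrite abscM absc_creal exprMn ger0_norm ?invr_ge0 ?ltW // mulrC.
by rewrite exprVn.
Qed.

(** Pythagoras: [c a] times [U] is the Hilbert-Schmidt projection of [K a] onto the line through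
    [U], and [U] has squared norm [d]. *)
Let hs_defect : \sum_a \sum_j \sum_i absc (D a j i) ^+ 2 = d * (1 - fidelity).
Proof.
have -> : d * (1 - fidelity) =
    \sum_a (\sum_j \sum_i absc (K a j i) ^+ 2 - d^-1 * absc (overlap (K a)) ^+ 2).
  rewrite sumrB isometry_hs -mulr_sumr /fidelity; field; exact: lt0r_neq0.
apply: eq_bigr => a _; apply: creal_inj.
have defect j i : creal (absc (D a j i) ^+ 2) = creal (absc (K a j i) ^+ 2)
    - c a * cconj (cconj (U j i) * K a j i) - cconj (c a) * (cconj (U j i) * K a j i)
    + cconj (c a) * c a * creal (absc (U j i) ^+ 2).
  by rewrite !absc_sqr /D cconjB !cconjM cconjK; ring.
rewrite creal_sum; under eq_bigr => j _.
  rewrite creal_sum; under eq_bigr do rewrite defect.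
  rewrite !big_split /= !sumrN -!mulr_sumr -!creal_sum -cconj_sum; over.
rewrite /= !big_split /= !sumrN -!mulr_sumr -!creal_sum -cconj_sum unitary_hs.
rewrite -/(overlap (K a)) /c cconjM cconj_creal crealB crealM absc_sqr.
have e : creal (d^-1) * creal d = 1 by rewrite -crealM mulVf ?creal1 // lt0r_neq0.
rewrite -addrA -addrA; congr (_ + _).
transitivity (creal (d^-1) * cconj (overlap (K a)) * overlap (K a) * (creal (d^-1) * creal d - 2)); first by ring.
by rewrite e; ring.
Qed.

Lemma fidelity_le1 : fidelity <= 1.
Proof.
have : 0 <= d * (1 - fidelity).
  rewrite -hs_defect; do 3! (apply: sumr_ge0 => ? _); exact: sqr_ge0.
by rewrite pmulr_rge0 // subr_ge0.
Qed.

Lemma fidelity_ge0 : 0 <= fidelity.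
Proof. by rewrite -sum_c; apply: sumr_ge0 => a _; exact: sqr_ge0. Qed.

Lemma unitary_channelE (X : op R I I) :
  opeq (unitary_channel U X) (kraus_map (fun _ : unit => U) (fun _ => U) X).
Proof.
move=> j j'; rewrite /kraus_map big_const card_unit /= addr0 exchange_big.
by apply: eq_bigr => i' _; rewrite /adj /mulop mulr_suml.
Qed.

Let isometryU : kraus_isometry (fun _ : unit => U).
Proof.
move=> i i'; rewrite big_const card_unit /= addr0.
by have [/(_ i i') + _] := unitaryU.
Qed.

(** Dimension one is separated because the final numerical estimate of the upper bound requires
    [2 <= d]. *)
Lemma fidelity1_dim1 : #|I| = 1%N -> fidelity = 1.
Proof.
move=> I1; have [i0 hi] : exists i0 : I, forall i, i = i0.
  have /card1P[i0 hi] : #|[pred _ : I | true]| == 1%N by apply/eqP; rewrite -[RHS]I1; apply: eq_card.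
  by exists i0 => i; have := hi i; rewrite !inE => /esym/eqP.
have s1 (f : I -> R) : \sum_i f i = f i0.
  by rewrite (bigD1 i0) //= big1 ?addr0 // => i; rewrite (hi i) eqxx.
have s1c (f : I -> C) : \sum_i f i = f i0.
  by rewrite (bigD1 i0) //= big1 ?addr0 // => i; rewrite (hi i) eqxx.
have := unitary_hs; rewrite !s1 => hU.
have := isometry_hs; under eq_bigr do rewrite !s1; move=> hK.
rewrite /fidelity; under eq_bigr do rewrite /overlap !s1c abscM absc_conj exprMn hU.
by rewrite -mulr_sumr hK; field; exact: lt0r_neq0.
Qed.

Variable N : sop R I I.
Hypothesis N_kraus : forall X, opeq (N X) (kraus_map K K X).

(* With K_a = D_a + c_a U, the difference N(Y) - U Y U^* is
   sum_a D_a Y K_a^* + sum_a c_a U Y D_a^* - (1 - F) U Y U^*. *)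
Lemma trnorm_channel_sub_le (Y : op R (I * I)%type (I * I)%type) : trnorm Y <= 1 ->
  trnorm (ext_id (sop_sub N (unitary_channel U)) Y) <= 2 * d * Num.sqrt (1 - fidelity).
Proof.
move=> Y1; set x := Num.sqrt (1 - fidelity).
have x0 : 0 <= x by exact: sqrtr_ge0.
have x2 : x ^+ 2 = 1 - fidelity by rewrite sqr_sqrtr // subr_ge0 fidelity_le1.
have x1 : x <= 1.
  by rewrite -(@ler_pXn2r _ 2) ?nnegrE // x2 expr1n gerBl fidelity_ge0.
set r := Num.sqrt d.
have r0 : 0 <= r by exact: sqrtr_ge0.
have r2 : r ^+ 2 = d by rewrite sqr_sqrtr // ltW.
have bD : op_bound D (r * x).
  by apply: op_bound_hs; rewrite hs_defect exprMn r2 x2.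
have bK : op_bound K 1 := op_bound_isometry isometryK.
have bU : op_bound (fun _ : unit => U) 1 := op_bound_isometry isometryU.
have bUc : op_bound (fun a j i => c a * U j i) 1.
  move=> u; apply: le_trans (ler_wpM2r (nsq_ge0 u) (_ : \sum_a absc (c a) ^+ 2 <= _)); last first.
    by rewrite sum_c expr1n fidelity_le1.
  rewrite mulr_suml; apply: ler_sum => a _.
  have := bU u; rewrite big_const card_unit /= addr0 expr1n mul1r => hu.
  apply: le_trans (ler_wpM2l (sqr_ge0 _) hu).
  rewrite /nsq mulr_sumr; apply: ler_sum => j _.
  under eq_bigr do rewrite -mulrA.
  by rewrite -mulr_sumr abscM exprMn.
have bUx : op_bound (fun (_ : unit) j i => creal (- x ^+ 2) * U j i) (x ^+ 2).
  move=> u; rewrite big_const card_unit /= addr0.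
  have := bU u; rewrite big_const card_unit /= addr0 expr1n mul1r => hu.
  apply: le_trans (ler_wpM2l (sqr_ge0 _) hu).
  rewrite /nsq mulr_sumr; apply: ler_sum => j _.
  under eq_bigr do rewrite -mulrA.
  by rewrite -mulr_sumr abscM exprMn absc_creal normrN ger0_norm // sqr_ge0.
have e : opeq (ext_id (sop_sub N (unitary_channel U)) Y)
  (addop (addop (ext_id (kraus_map D K) Y) (ext_id (kraus_map (fun a j i => c a * U j i) D) Y))
     (ext_id (kraus_map (fun (_ : unit) j i => creal (- x ^+ 2) * U j i) (fun _ => U)) Y)).
  move=> m n; rewrite /addop /ext_id /sop_sub /subop N_kraus unitary_channelE.
  rewrite /kraus_map ![\sum_(_ : unit) _]big_const card_unit /= !addr0.
  set u := \sum_i \sum_i' U m.1 i * Y (i, m.2) (i', n.2) * cconj (U n.1 i').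
  have -> : \sum_i \sum_i' creal (- x ^+ 2) * U m.1 i * Y (i, m.2) (i', n.2) * cconj (U n.1 i')
      = creal (- x ^+ 2) * u.
    rewrite mulr_sumr; apply: eq_bigr => i _; rewrite mulr_sumr.
    by apply: eq_bigr => i' _; rewrite !mulrA.
  rewrite -big_split /= [in RHS](eq_bigr (fun a => \sum_i \sum_i' K a m.1 i * Y (i, m.2) (i', n.2) * cconj (K a n.1 i')
      - creal (absc (c a) ^+ 2) * u)) => [|a _].
    rewrite sumrB -mulr_suml -creal_sum sum_c x2 opprB crealB creal1; ring.
  rewrite mulr_sumr -big_split -sumrB; apply: eq_bigr => i _ /=.
  rewrite mulr_sumr -big_split -sumrB; apply: eq_bigr => i' _ /=.
  by rewrite /D cconjB [cconj (c a * _)]cconjM absc_sqr; ring.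
have := pairing_leD (pairing_leD
  (pairing_le_kraus Y (mulr_ge0 r0 x0) ler01 bD bK)
  (pairing_le_kraus Y ler01 (mulr_ge0 r0 x0) bUc bD))
  (pairing_le_kraus Y (sqr_ge0 x) ler01 bUx bU).
move=> /(eq_pairing_le e)/trnorm_le/le_trans; apply.
rewrite !mulr1 !mul1r -!mulrDl.
apply: le_trans (ler_piMr _ Y1) _; first by do ?[apply: addr_ge0 | apply: mulr_ge0 | apply: sqr_ge0].
(* The three terms add up to [2 r x + x^2], to be compared with [2 r^2 x]. Since [x <= 1], it
   suffices that [1 <= 2 r (r - 1)], which fails for [d = 1]. *)
have : (#|I| == 1)%N || (1 < #|I|)%N by case: (#|I|) I_gt0 => [|[]].
case/orP => [/eqP/fidelity1_dim1 F1|I2].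
  have -> : x = 0 by rewrite /x F1 subrr sqrtr0.
  by rewrite !mulr0.
have d2 : 2 <= d by rewrite (ler_nat R 2).
(* A rational lower bound for the square root of 2, large enough for [2 r (r - 1)] to exceed 1. *)
have r14 : 7 / 5 <= r.
  by rewrite -(@ler_pXn2r _ 2) ?nnegrE //; [rewrite r2; lra | lra].
have : 0 <= x * (2 * r * (r - 1) - x) by apply: mulr_ge0 => //; nra.
rewrite -r2; lra.
Qed.

Let sq : R := Num.sqrt d^-1.
Let sq2 : sq ^+ 2 = d^-1.
Proof. by rewrite sqr_sqrtr // invr_ge0 ltW. Qed.

Definition maxent (m : I * I) : C := creal sq * (m.1 == m.2)%:R.

Lemma maxent_unit : unit_vec maxent.
Proof.
rewrite /unit_vec.
transitivity (\sum_(i : I) \sum_(j : I) creal (d^-1) * ((i == j)%:R * (i == j)%:R : C)).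
  rewrite pair_bigA /=; apply: eq_bigr => -[i j] _.
  by rewrite /maxent /= cconjM cconj_creal cconj_nat -sq2 crealX; ring.
under eq_bigr do rewrite -mulr_sumr sum_deltal eqxx mulr1.
by rewrite sumr_const -mulr_natr -dE -crealM mulVf ?lt0r_neq0.
Qed.

(* The reflection 1 - 2 |phi><phi| about the Choi vector phi of U detects twice
   the infidelity, because the difference of the two channels is traceless. *)
Lemma infidelity_le : 2 * (1 - fidelity) <=
  trnorm (ext_id (sop_sub N (unitary_channel U)) (proj maxent)).
Proof.
set X := ext_id _ _.
pose phi (m : I * I) : C := creal sq * U m.1 m.2.
have phi1 : unit_vec phi.
  rewrite /unit_vec (eq_bigr (fun m => creal (d^-1) * (cconj (U m.1 m.2) * U m.1 m.2))) => [|m _].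
    rewrite -mulr_sumr.
    rewrite -(pair_bigA _ (fun i j => cconj (U i j) * U i j)) /=.
    under eq_bigr do under eq_bigr do rewrite -absc_sqr.
    under eq_bigr do rewrite -creal_sum.
    by rewrite -creal_sum unitary_hs -crealM mulVf // lt0r_neq0.
  by rewrite /phi cconjM cconj_creal -sq2 crealX; ring.
(* The Choi operator is a sum of rank-one operators on the vectorized Kraus operators, with weight
   [d^-1]. *)
have kraus_choi (S : finType) (P : S -> op R I I) m n :
    ext_id (kraus_map P P) (proj maxent) m n =
    creal (d^-1) * \sum_a P a m.1 m.2 * cconj (P a n.1 n.2).
  rewrite mulr_sumr; apply: eq_bigr => a _.
  transitivity (\sum_i (creal (d^-1) * (\sum_i' cconj (P a n.1 i') * (i' == n.2)%:R)) *
     (P a m.1 i * (i == m.2)%:R)).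
    apply: eq_bigr => i _; rewrite mulr_sumr mulr_suml; apply: eq_bigr => i' _.
    by rewrite /proj /maxent /= cconjM cconj_creal cconj_nat -sq2 crealX; ring.
  by rewrite -mulr_sumr !sum_deltar; ring.
have XE m n : X m n = creal (d^-1) * (\sum_a K a m.1 m.2 * cconj (K a n.1 n.2) - U m.1 m.2 * cconj (U n.1 n.2)).
  rewrite mulrBr -kraus_choi /X /ext_id /sop_sub /subop N_kraus unitary_channelE.
  congr (_ - _); rewrite -[LHS]/(ext_id (kraus_map (fun _ : unit => U) (fun _ => U)) (proj maxent) m n).
  by rewrite kraus_choi big_const card_unit /= addr0.
have trX : trace X = 0.
  rewrite /trace; under eq_bigr do rewrite XE.
  rewrite -mulr_sumr sumrB.
  rewrite -(pair_bigA _ (fun i j => \sum_a K a i j * cconj (K a i j))) /=.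
  rewrite -(pair_bigA _ (fun i j => U i j * cconj (U i j))) /=.
  under eq_bigr do under eq_bigr do under eq_bigr do rewrite mulrC -absc_sqr.
  under eq_bigr do under eq_bigr do rewrite -creal_sum.
  under eq_bigr do rewrite -creal_sum.
  under [X in _ - X]eq_bigr do under eq_bigr do rewrite mulrC -absc_sqr.
  under [X in _ - X]eq_bigr do rewrite -creal_sum.
  rewrite -!creal_sum unitary_hs.
  under eq_bigr do rewrite exchange_big.
  by rewrite exchange_big /= isometry_hs subrr mulr0.
have fidX : \sum_m \sum_n cconj (phi m) * X m n * phi n = creal (fidelity - 1).
  have ov (P : op R I I) : \sum_m cconj (phi m) * P m.1 m.2 = creal sq * overlap P.
    rewrite /overlap pair_bigA mulr_sumr; apply: eq_bigr => m _ /=.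
    by rewrite /phi cconjM cconj_creal; ring.
  have ovc (P : op R I I) : \sum_m cconj (P m.1 m.2) * phi m = creal sq * cconj (overlap P).
    rewrite -[creal sq]cconj_creal -cconjM -ov cconj_sum; apply: eq_bigr => m _.
    by rewrite cconjM cconjK mulrC.
  have ovU : overlap U = creal d.
    rewrite -unitary_hs /overlap creal_sum; apply: eq_bigr => j _.
    by rewrite creal_sum; apply: eq_bigr => i _; rewrite absc_sqr.
  have rank1 (P : op R I I) : \sum_m \sum_n (cconj (phi m) * P m.1 m.2) * (cconj (P n.1 n.2) * phi n) =
      creal (d^-1 * absc (overlap P) ^+ 2).
    rewrite -big_distrlr ov ovc crealM absc_sqr -sq2 crealX /=; ring.
  transitivity (creal (d^-1) * (\sum_a creal (d^-1 * absc (overlap (K a)) ^+ 2)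
      - creal (d^-1 * absc (overlap U) ^+ 2))).
    have XphiE m n : cconj (phi m) * X m n * phi n = creal (d^-1) *
        (\sum_a (cconj (phi m) * K a m.1 m.2) * (cconj (K a n.1 n.2) * phi n)
         - (cconj (phi m) * U m.1 m.2) * (cconj (U n.1 n.2) * phi n)).
      rewrite XE [in RHS](eq_bigr (fun a => (cconj (phi m) * phi n) *
        (K a m.1 m.2 * cconj (K a n.1 n.2)))) => [|a _]; last by ring.
      by rewrite -mulr_sumr; ring.
    under eq_bigr => m _.
      under eq_bigr do rewrite XphiE.
      rewrite -mulr_sumr sumrB exchange_big; over.
    rewrite -mulr_sumr sumrB exchange_big rank1; congr (_ * (_ - _)).
    by apply: eq_bigr => a _; exact: rank1.
  rewrite -creal_sum -crealB -crealM; congr creal.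
  rewrite ovU absc_creal ger0_norm ?ltW // -mulr_sumr /fidelity; field; exact: lt0r_neq0.
have := trace_reflection_le X phi1; rewrite trX fidX; apply: le_trans.
rewrite sub0r -(creal_nat 2) -crealM -crealN absc_creal.
by apply: le_trans (ler_norm _); lra.
Qed.

Lemma diamond_norm_le : diamond_norm (sop_sub N (unitary_channel U)) <= 2 * d * Num.sqrt (1 - fidelity).
Proof.
apply: ge_sup => [|_ [Y Y1 <-]]; last exact: trnorm_channel_sub_le.
by exists (trnorm (ext_id (sop_sub N (unitary_channel U)) (proj maxent))), (proj maxent) => //; exact/trnorm_proj_le1/maxent_unit.
Qed.

(** The maximally entangled input is admissible. A member lies below [sup] only if the set is
    bounded, which is where the upper estimate enters. *)
Lemma infidelity_le_diamond : 2 * (1 - fidelity) <= diamond_norm (sop_sub N (unitary_channel U)).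
Proof.
apply: le_trans infidelity_le _; apply: ub_le_sup.
  by exists (2 * d * Num.sqrt (1 - fidelity)) => _ [Y Y1 <-]; exact: trnorm_channel_sub_le.
by exists (proj maxent) => //; exact/trnorm_proj_le1/maxent_unit.
Qed.

End DiamondDistance.

(** * Channels in Kraus form, resource ensembles and convexity inequalities *)

Section Channels.
Set Implicit Arguments.
Unset Strict Implicit.
Context {R : realType}.
Local Notation C := R[i].
Implicit Types (I J L T : finType).

(** Any finite index type is allowed, so that composites can be indexed by pairs and mixtures by
    ensemble members. *)
Definition cptp {I J} (N : sop R I J) := exists (T : finType) (K : T -> op R J I),
  kraus_isometry K /\ forall X, opeq (N X) (kraus_map K K X).

Lemma eq_kraus_map I J T (P Q : T -> op R J I) (X Y : op R I I) :
  opeq X Y -> opeq (kraus_map P Q X) (kraus_map P Q Y).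
Proof.
move=> e j j'; apply: eq_bigr => a _; apply: eq_bigr => i _; apply: eq_bigr => i' _.
by rewrite e.
Qed.

Lemma cptp_linear I J T (N : sop R I J) (c : T -> C) (X : op R I I) (Z : T -> op R I I) :
  cptp N -> opeq X (fun i j => \sum_t c t * Z t i j) ->
  opeq (N X) (fun i j => \sum_t c t * N (Z t) i j).
Proof.
move=> [S [K [_ NK]]] eX j j'; rewrite NK.
under [RHS]eq_bigr do rewrite NK mulr_sumr.
rewrite [RHS]exchange_big; apply: eq_bigr => a _ /=.
under [RHS]eq_bigr do rewrite mulr_sumr.
rewrite [RHS]exchange_big; apply: eq_bigr => i _ /=.
under [RHS]eq_bigr do rewrite mulr_sumr.
rewrite [RHS]exchange_big; apply: eq_bigr => i' _ /=.
rewrite eX mulr_sumr mulr_suml; apply: eq_bigr => t _; ring.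
Qed.

Lemma cptp_comp I J L (N : sop R I J) (M : sop R J L) :
  cptp N -> cptp M -> cptp (fun X => M (N X)).
Proof.
move=> [S [K [iK NK]]] [T [H [iH MH]]].
exists (S * T)%type, (fun a => mulop (H a.2) (K a.1)); split.
  move=> i i'; rewrite -iK.
  rewrite -(pair_bigA _ (fun s t => \sum_l cconj (mulop (H t) (K s) l i) * mulop (H t) (K s) l i')) /=.
  apply: eq_bigr => s _.
  (* Summing over the outer family first collapses it to the identity by [iH]. *)
  transitivity (\sum_j \sum_j' cconj (K s j i) * ((\sum_t \sum_l cconj (H t l j) * H t l j') * K s j' i')).
    under [RHS]eq_bigr => j _ do under eq_bigr => j' _ do rewrite mulr_suml mulr_sumr.
    under [RHS]eq_bigr do rewrite exchange_big.
    rewrite [RHS]exchange_big; apply: eq_bigr => t _ /=.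
    under [RHS]eq_bigr => j _ do under eq_bigr => j' _ do rewrite mulr_suml mulr_sumr.
    under [RHS]eq_bigr do rewrite exchange_big.
    rewrite [RHS]exchange_big; apply: eq_bigr => l _ /=.
    rewrite cconj_sum big_distrlr; apply: eq_bigr => j _; apply: eq_bigr => j' _ /=.
    by rewrite cconjM; ring.
  apply: eq_bigr => j _; under eq_bigr do rewrite iH.
  by rewrite -mulr_sumr sum_deltal.
move=> X l l'; rewrite MH (eq_kraus_map _ _ (NK X)) /kraus_map.
rewrite -(pair_bigA _ (fun s t => \sum_i \sum_i' mulop (H t) (K s) l i * X i i' * cconj (mulop (H t) (K s) l' i'))) /=.
rewrite [RHS]exchange_big; apply: eq_bigr => t _ /=.
under eq_bigr => j _ do under eq_bigr => j' _ do rewrite mulr_sumr mulr_suml.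
under eq_bigr do rewrite exchange_big.
rewrite exchange_big; apply: eq_bigr => s _ /=.
under eq_bigr => j _ do under eq_bigr => j' _ do rewrite mulr_sumr mulr_suml.
under eq_bigr do rewrite exchange_big.
rewrite exchange_big; apply: eq_bigr => i _ /=.
under eq_bigr => j _ do under eq_bigr => j' _ do rewrite mulr_sumr mulr_suml.
under eq_bigr do rewrite exchange_big.
rewrite exchange_big; apply: eq_bigr => i' _ /=.
rewrite /mulop cconj_sum -mulrA [X in _ * X]mulrC mulrA big_distrlr mulr_suml.
apply: eq_bigr => j _; rewrite mulr_suml; apply: eq_bigr => j' _ /=.
by rewrite cconjM; ring.
Qed.

Lemma cptp_kraus_apply I J (Ks : seq (op R J I)) : is_channel Ks -> cptp (kraus_apply Ks).
Proof.
move=> hK; exists 'I_(size Ks), (fun a => tnth (in_tuple Ks) a); split.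
  by move=> i i'; rewrite -[RHS]hK [RHS]big_tnth.
move=> X j j'; rewrite /kraus_apply big_tnth; apply: eq_bigr => a _.
rewrite /mulop /adj exchange_big; apply: eq_bigr => i' _.
by rewrite mulr_suml.
Qed.

Lemma is_channel_tens I1 J1 I2 J2 (K1 : seq (op R J1 I1)) (K2 : seq (op R J2 I2)) :
  is_channel K1 -> is_channel K2 -> is_channel (kraus_tens K1 K2).
Proof.
move=> h1 h2 [i1 i2] [i1' i2']; rewrite /kraus_tens big_allpairs_dep /=.
have -> : @idop R (I1 * I2)%type (i1, i2) (i1', i2') = @idop R I1 i1 i1' * @idop R I2 i2 i2'.
  by rewrite /idop xpair_eqE -natrM mulnb.
rewrite -h1 -h2 mulr_suml; apply: eq_bigr => A1 _; rewrite mulr_sumr; apply: eq_bigr => A2 _.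
rewrite /mulop /adj big_distrlr pair_bigA /=; apply: eq_bigr => -[j1 j2] _.
by rewrite /tens /= cconjM; ring.
Qed.

(** Relabelling along a bijection is conjugation by a permutation matrix. *)
Lemma cptp_reindex I J (f : J -> I) : bijective f -> cptp (fun X : op R I I => Defs.reindex f f X).
Proof.
move=> bf; exists unit, (fun _ j i => (f j == i)%:R); split.
  move=> i i'; rewrite big_const card_unit /= addr0.
  rewrite -(sum_deltal i (fun k => (k == i')%:R)) [RHS](reindex f) /=; last exact: onW_bij.
  by apply: eq_bigr => j _; rewrite cconj_nat eq_sym.
move=> X j j'; rewrite /kraus_map big_const card_unit /= addr0.
under eq_bigr do under eq_bigr do rewrite -mulrA.
under eq_bigr do rewrite -mulr_sumr.
rewrite sum_deltal; under eq_bigr do rewrite cconj_nat eq_sym.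
by rewrite sum_deltar.
Qed.

(** The Kraus operators are [sqrt (p k)] times the identity tensored with the vector [psi k]. *)
Lemma cptp_append I L1 L2 (Psi : op R (L1 * L2)%type (L1 * L2)%type) n (p : 'I_n -> R)
    (psi : 'I_n -> (L1 * L2)%type -> C) :
  ensemble Psi p psi -> cptp (fun X : op R I I => tens X Psi).
Proof.
move=> [p0 p1 psi1 PsiE].
exists 'I_n, (fun k m i => creal (Num.sqrt (p k)) * ((m.1 == i)%:R * psi k m.2)).
have sp k : creal (Num.sqrt (p k)) * creal (Num.sqrt (p k)) = creal (p k).
  by rewrite -crealM -expr2 sqr_sqrtr.
split.
  move=> i i'; transitivity ((i == i')%:R * creal (\sum_k p k)); last by rewrite p1 creal1 mulr1.
  rewrite creal_sum mulr_sumr; apply: eq_bigr => k _.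
  rewrite -(pair_bigA _ (fun j x => cconj (creal (Num.sqrt (p k)) * ((j == i)%:R * psi k x)) *
    (creal (Num.sqrt (p k)) * ((j == i')%:R * psi k x)))) /=.
  transitivity (\sum_j (i == j)%:R * ((j == i')%:R * creal (p k))); last by rewrite sum_deltal.
  apply: eq_bigr => j _.
  transitivity ((i == j)%:R * ((j == i')%:R * creal (p k)) * \sum_x cconj (psi k x) * psi k x); last first.
    by rewrite psi1 mulr1.
  rewrite mulr_sumr; apply: eq_bigr => x _.
  by rewrite !cconjM cconj_creal cconj_nat -sp eq_sym; ring.
move=> X m m'; rewrite /tens PsiE mulr_sumr; apply: eq_bigr => k _.
transitivity (creal (p k) * proj (psi k) m.2 m'.2 *
   \sum_i (m.1 == i)%:R * \sum_i' X i i' * (i' == m'.1)%:R).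
  by rewrite sum_deltal sum_deltar; ring.
rewrite mulr_sumr; apply: eq_bigr => i _; rewrite !mulr_sumr; apply: eq_bigr => i' _.
by rewrite /proj !cconjM cconj_creal cconj_nat -sp [i' == _]eq_sym; ring.
Qed.

(** The protocol after the resource is appended. Isolating it shows that the output depends linearly
    on [tens X Psi], hence on [Psi]. *)
Definition nlqc_rest {A B L Rr Ka Ma Kb Mb : finType}
  (V : seq (op R (Ka * Mb)%type (A * L)%type)) (V' : seq (op R (Ma * Kb)%type (Rr * B)%type))
  (W : seq (op R A (Ka * Ma)%type)) (W' : seq (op R B (Kb * Mb)%type))
  (Z : op R ((A * B) * (L * Rr))%type ((A * B) * (L * Rr))%type) : op R (A * B)%type (A * B)%type :=
  kraus_apply (kraus_tens W W')
    (Defs.reindex (fun y : ((Ka * Ma) * (Kb * Mb))%type => ((y.1.1, y.2.2), (y.1.2, y.2.1)))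
             (fun y : ((Ka * Ma) * (Kb * Mb))%type => ((y.1.1, y.2.2), (y.1.2, y.2.1)))
      (kraus_apply (kraus_tens V V')
        (Defs.reindex (fun x : ((A * L) * (Rr * B))%type => ((x.1.1, x.2.2), (x.1.2, x.2.1)))
                 (fun x : ((A * L) * (Rr * B))%type => ((x.1.1, x.2.2), (x.1.2, x.2.1))) Z))).

Lemma cptp_nlqc_rest (A B L Rr Ka Ma Kb Mb : finType)
  (V : seq (op R (Ka * Mb)%type (A * L)%type)) (V' : seq (op R (Ma * Kb)%type (Rr * B)%type))
  (W : seq (op R A (Ka * Ma)%type)) (W' : seq (op R B (Kb * Mb)%type)) :
  nlqc_valid V V' W W' -> cptp (nlqc_rest V V' W W').
Proof.
move=> [hV hV' hW hW'].
apply: (cptp_comp (M := kraus_apply (kraus_tens W W'))); last exact/cptp_kraus_apply/is_channel_tens.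
apply: (cptp_comp (M := fun Z => Defs.reindex _ _ Z)); last first.
  apply: cptp_reindex.
  exists (fun z : (Ka * Mb) * (Ma * Kb) => ((z.1.1, z.2.1), (z.2.2, z.1.2))).
    by move=> [[a b] [c d]].
  by move=> [[a b] [c d]].
apply: (cptp_comp (M := kraus_apply (kraus_tens V V'))); last exact/cptp_kraus_apply/is_channel_tens.
apply: cptp_reindex.
exists (fun z : (A * B) * (L * Rr) => ((z.1.1, z.2.1), (z.2.2, z.1.2))).
  by move=> [[a b] [c d]].
by move=> [[a b] [c d]].
Qed.

Lemma cptp_nlqc (A B L Rr Ka Ma Kb Mb : finType)
  (V : seq (op R (Ka * Mb)%type (A * L)%type)) (V' : seq (op R (Ma * Kb)%type (Rr * B)%type))
  (W : seq (op R A (Ka * Ma)%type)) (W' : seq (op R B (Kb * Mb)%type))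
  (Psi : op R (L * Rr)%type (L * Rr)%type) n (p : 'I_n -> R) psi :
  nlqc_valid V V' W W' -> ensemble Psi p psi -> cptp (nlqc V V' W W' Psi).
Proof.
move=> hV /cptp_append h.
exact: (cptp_comp (h _) (cptp_nlqc_rest hV)).
Qed.

Lemma nlqc_mixture (A B L Rr Ka Ma Kb Mb : finType)
  (V : seq (op R (Ka * Mb)%type (A * L)%type)) (V' : seq (op R (Ma * Kb)%type (Rr * B)%type))
  (W : seq (op R A (Ka * Ma)%type)) (W' : seq (op R B (Kb * Mb)%type))
  (Psi : op R (L * Rr)%type (L * Rr)%type) n (p : 'I_n -> R) psi X :
  nlqc_valid V V' W W' -> ensemble Psi p psi ->
  opeq (nlqc V V' W W' Psi X)
       (fun i j => \sum_k creal (p k) * nlqc V V' W W' (proj (psi k)) X i j).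
Proof.
move=> hV [_ _ _ PsiE].
have h : opeq (tens X Psi) (fun i j => \sum_k creal (p k) * tens X (proj (psi k)) i j).
  by move=> i j; rewrite /tens PsiE mulr_sumr; apply: eq_bigr => k _; rewrite mulrCA.
exact: (cptp_linear (cptp_nlqc_rest hV) h).
Qed.

Lemma ensemble_proj (L Rr : finType) (psi : (L * Rr)%type -> C) :
  unit_vec psi -> ensemble (proj psi) (fun _ : 'I_1 => 1) (fun _ => psi).
Proof.
by move=> psi1; split=> // [|x y]; rewrite big_ord1 // creal1 mul1r.
Qed.

(** Nonnegativity in the order of the complex numbers includes reality, so the quadratic form of
    [B], the difference of [X] and its adjoint, vanishes. Polarization then gives [B = 0]. *)
Lemma psd_hermitian I (X : op R I I) : psd X -> forall i j, X i j = cconj (X j i).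
Proof.
move=> pX i j.
pose B a b := X a b - cconj (X b a).
pose v t k : C := (i == k)%:R + t * (j == k)%:R.
have vs t (f : I -> C) : \sum_k f k * v t k = f i + t * f j.
  under eq_bigr do rewrite mulrDr mulrCA (eq_sym i) (eq_sym j).
  by rewrite big_split /= -mulr_sumr !sum_deltar.
have Bv t : B i i + t * B i j + cconj t * (B j i + t * B j j) = 0.
  have q : \sum_a \sum_b cconj (v t a) * B a b * v t b = 0.
    have /(ger0_Im) := pX (v t).
    set q := \sum_a _ => q0.
    have -> : \sum_a \sum_b cconj (v t a) * B a b * v t b = q - cconj q.
      rewrite /q cconj_sum; under [X in _ - X]eq_bigr do rewrite cconj_sum.
      rewrite [X in _ - X]exchange_big -sumrB; apply: eq_bigr => a _.
      rewrite -sumrB; apply: eq_bigr => b _.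
      by rewrite /B [cconj (_ * v t a)]cconjM [cconj (_ * X b a)]cconjM cconjK; ring.
    by move: q0; case: q => a b /= ->; rewrite /cconj /= oppr0 subrr.
  rewrite -[RHS]q; under eq_bigr do rewrite vs mulrC.
  transitivity (cconj (\sum_a (cconj (B a i + t * B a j)) * v t a)).
    by rewrite vs cconjD cconjM !cconjK.
  rewrite cconj_sum; apply: eq_bigr => a _.
  by rewrite cconjM cconjK; ring.
have B1 := Bv 1; have Bm := Bv (- 1); have Bi := Bv 'i%C.
have ci : cconj 'i%C = - 'i%C :> C by rewrite /cconj /=; apply/eqP; rewrite eq_complex /= oppr0 !eqxx.
have c1 : cconj 1 = 1 :> C by exact: conjc1.
have cN1 : cconj (- 1) = - 1 :> C by exact: (rmorphN1 (@conjc R)).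
rewrite c1 in B1; rewrite cN1 in Bm; rewrite ci in Bi.
have eji : - 'i%C * (B j i + 'i%C * B j j) = - 'i%C * B j i - 'i%C ^+ 2 * B j j by ring.
rewrite eji sqr_i mulN1r opprK in Bi.
(* With [E t] the value of the form at [e_i + t e_j], the combination [i (E 1 - E (-1)) + 2 E i - (E
   1 + E (-1))] leaves only the entry [B i j]. *)
have e : 4 * ('i%C * B i j) = 0.
  transitivity ('i%C * ((B i i + 1 * B i j + 1 * (B j i + 1 * B j j))
      - (B i i + -1 * B i j + -1 * (B j i + -1 * B j j)))
      + 2 * (B i i + 'i%C * B i j + (- 'i%C * B j i + B j j))
      - ((B i i + 1 * B i j + 1 * (B j i + 1 * B j j))
      + (B i i + -1 * B i j + -1 * (B j i + -1 * B j j)))); first by ring.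
  by rewrite B1 Bm Bi !subr0 !mulr0 !addr0 subr0.
have {}e : B i j = 0.
  have i0 : 'i%C != 0 :> C by rewrite eq_complex /= oner_eq0 andbF.
  by move/eqP: e; rewrite mulf_eq0 pnatr_eq0 /= mulf_eq0 (negPf i0) /= => /eqP.
by apply/eqP; rewrite -subr_eq0; apply/eqP.
Qed.

(** Eigenvectors weighted by eigenvalues. This makes the set whose infimum defines [ent_formation]
    nonempty. *)
Lemma density_ensemble (L Rr : finType) (Psi : op R (L * Rr)%type (L * Rr)%type) :
  density Psi -> exists n (p : 'I_n -> R) psi, ensemble Psi p psi.
Proof.
move=> [pPsi tr1].
have [q [U [[U1 U2] PsiE]]] := hermitian_spectrum (psd_hermitian pPsi).
have {}PsiE i j : Psi i j = \sum_k creal (q k) * (U i k * cconj (U j k)).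
  by rewrite PsiE spectral_formE.
have {}U1 k l : \sum_i cconj (U i k) * U i l = (k == l)%:R by exact: U1.
have sum_enum (f : L * Rr -> C) : \sum_(k < #|{: L * Rr}|) f (enum_val k) = \sum_k f k.
  rewrite [RHS](bigop.reindex (@enum_val _ {: L * Rr})) //=.
  exact/onW_bij/enum_val_bij.
exists #|{: L * Rr}|, (fun k => q (enum_val k)), (fun k i => U i (enum_val k)); split.
- move=> k; set l := enum_val k; have := pPsi (fun i => U i l).
  have -> : \sum_i \sum_j cconj (U i l) * Psi i j * U j l =
      \sum_m (l == m)%:R * (creal (q m) * (m == l)%:R).
    under eq_bigr => i _ do under eq_bigr => j _ do rewrite PsiE mulr_sumr mulr_suml.
    under eq_bigr do rewrite exchange_big.
    rewrite exchange_big; apply: eq_bigr => m _ /=.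
    rewrite -!U1 [in RHS]mulr_sumr big_distrlr; apply: eq_bigr => i _ /=.
    by apply: eq_bigr => j _; ring.
  by rewrite sum_deltal eqxx mulr1 -creal0 lecR.
- apply: creal_inj; rewrite creal_sum (sum_enum (fun k => creal (q k))) creal1 -tr1 /trace.
  under [RHS]eq_bigr do rewrite PsiE.
  rewrite exchange_big; apply: eq_bigr => k _ /=.
  rewrite -mulr_sumr; under eq_bigr do rewrite mulrC.
  by rewrite U1 eqxx mulr1.
- by move=> k; rewrite /unit_vec U1 eqxx.
- move=> i j; rewrite PsiE.
  by rewrite (sum_enum (fun k => creal (q k) * (U i k * cconj (U j k)))).
Qed.

(** Induction on a list of indices with unnormalized weights, carrying the weighted mean [m] as a
    witness; this avoids dividing by a total weight that may be zero. *)
Lemma concave_jensen (F : R -> R) T (p e : T -> R) :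
  concave_on_nonneg F -> (forall t, 0 <= p t) -> (forall t, 0 <= e t) -> \sum_t p t = 1 ->
  \sum_t p t * F (e t) <= F (\sum_t p t * e t).
Proof.
move=> cF p0 e0 p1.
suff : forall r : seq T, exists m : R, [/\ 0 <= m, 0 <= \sum_(t <- r) p t,
    \sum_(t <- r) p t * e t = (\sum_(t <- r) p t) * m &
    \sum_(t <- r) p t * F (e t) <= (\sum_(t <- r) p t) * F m].
  by move=> /(_ (index_enum T))[m [_ _ -> +]]; rewrite p1 !mul1r.
elim=> [|t r [m [m0 w0 mE FE]]]; first by exists 0; rewrite !big_nil !mul0r.
rewrite !big_cons; set w := \sum_(t <- r) p t in w0 mE FE *.
(* If all weights so far vanish, every sum is zero and the old [m] still serves. *)
have [W0|W0] := eqVneq (p t + w) 0.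
  have [pt0 w00] : p t = 0 /\ w = 0 by have := p0 t; lra.
  by exists m; rewrite mE pt0 w00 !mul0r !add0r; split; rewrite ?mul0r //; move: FE; rewrite w00 mul0r.
have Wp : 0 < p t + w by rewrite lt0r W0 addr_ge0.
set s := p t / (p t + w).
have sE : (p t + w) * s = p t by rewrite /s mulrC divfK.
have oE : (p t + w) * (1 - s) = w by rewrite mulrBr mulr1 sE addrC addKr.
have s01 : 0 <= s <= 1.
  by rewrite /s divr_ge0 ?(ltW Wp) // ler_pdivrMr // mul1r lerDl.
have /andP[s0 s1] := s01.
clearbody s.
exists (s * e t + (1 - s) * m); split.
- by apply: addr_ge0; apply: mulr_ge0; rewrite ?subr_ge0.
- exact: ltW.
- by rewrite mE mulrDr !mulrA sE oE.
- apply: le_trans (ler_wpM2l (ltW Wp) (cF _ _ _ (e0 t) m0 s01)).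
  by rewrite mulrDr !mulrA sE oE lerD2l.
Qed.

(** Cauchy-Schwarz for [sqrt (p t)] and [sqrt (p t) * sqrt (x t)], with the weights summing to 1. *)
Lemma sum_sqrt_le T (p x : T -> R) :
  (forall t, 0 <= p t) -> (forall t, 0 <= x t) -> \sum_t p t = 1 ->
  \sum_t p t * Num.sqrt (x t) <= Num.sqrt (\sum_t p t * x t).
Proof.
move=> p0 x0 p1.
rewrite -(@ler_pXn2r _ 2) ?nnegrE ?sqrtr_ge0 //; last first.
  by apply: sumr_ge0 => t _; rewrite mulr_ge0 ?sqrtr_ge0.
rewrite sqr_sqrtr; last by apply: sumr_ge0 => t _; rewrite mulr_ge0.
have := cauchy_schwarz_real xpredT (fun t => Num.sqrt (p t)) (fun t => Num.sqrt (p t) * Num.sqrt (x t)).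
under eq_bigr do rewrite mulrA -expr2 sqr_sqrtr //.
under [X in _ <= X * _]eq_bigr do rewrite sqr_sqrtr //.
under [X in _ <= _ * X]eq_bigr do rewrite exprMn !sqr_sqrtr //.
by rewrite p1 mul1r.
Qed.

End Channels.

(** * Choi fidelity as an affine function of the channel, and errors in a mixture *)

Section ChannelFidelity.
Set Implicit Arguments.
Unset Strict Implicit.
Context {R : realType}.
Local Notation C := R[i].
Context {I : finType} (U : op R I I).
Hypothesis unitaryU : unitary U.

Definition matrix_unit (i i' : I) : op R I I := fun k k' => (k == i)%:R * (k' == i')%:R.

(* Overlap of the Choi operators of N and U; equals [fidelity U K] for every
   Kraus representation K of N but is manifestly affine in N. *)
Definition choi_fidelity (N : sop R I I) : R :=
  complex.Re (\sum_j \sum_i \sum_j' \sum_i'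
    cconj (U j i) * N (matrix_unit i i') j j' * U j' i') / #|I|%:R ^+ 2.

(** On matrix units each Kraus term is a product of two entries, so the fourfold sum factors into
    squared moduli of overlaps. *)
Lemma choi_fidelity_kraus (T : finType) (K : T -> op R I I) (N : sop R I I) :
  (forall X, opeq (N X) (kraus_map K K X)) -> choi_fidelity N = fidelity U K.
Proof.
move=> NK; rewrite /choi_fidelity /fidelity; congr (_ / _).
rewrite -[RHS]/(complex.Re (creal _)) creal_sum; congr complex.Re.
under [RHS]eq_bigr do rewrite absc_sqr mulrC /overlap mulr_suml.
rewrite [RHS]exchange_big; apply: eq_bigr => j _ /=.
under [RHS]eq_bigr do rewrite mulr_suml.
rewrite [RHS]exchange_big; apply: eq_bigr => i _ /=.
under [RHS]eq_bigr do rewrite cconj_sum mulr_sumr.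
rewrite [RHS]exchange_big; apply: eq_bigr => j' _ /=.
under [RHS]eq_bigr do rewrite cconj_sum mulr_sumr.
rewrite [RHS]exchange_big; apply: eq_bigr => i' _ /=.
rewrite NK mulr_sumr mulr_suml; apply: eq_bigr => a _.
have -> : \sum_k \sum_k' K a j k * matrix_unit i i' k k' * cconj (K a j' k') =
    K a j i * cconj (K a j' i').
  rewrite -(sum_deltar i (K a j)) -(sum_deltar i' (fun k => cconj (K a j' k))).
  rewrite big_distrlr; apply: eq_bigr => k _; apply: eq_bigr => k' _ /=.
  by rewrite /matrix_unit; ring.
by rewrite cconjM cconjK; ring.
Qed.

Lemma choi_fidelity_mixture (T : finType) (p : T -> R) (N : sop R I I) (M : T -> sop R I I) :
  (forall X, opeq (N X) (fun i j => \sum_t creal (p t) * M t X i j)) ->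
  choi_fidelity N = \sum_t p t * choi_fidelity (M t).
Proof.
move=> NM; rewrite /choi_fidelity.
under [RHS]eq_bigr do rewrite mulrA.
rewrite -mulr_suml; congr (_ / _).
have ReM (x : R) (z : C) : complex.Re (creal x * z) = x * complex.Re z.
  by case: z => a b /=; rewrite mul0r subr0.
under [RHS]eq_bigr do rewrite -ReM.
have ReS (f : T -> C) : \sum_t complex.Re (f t) = complex.Re (\sum_t f t).
  by rewrite (raddf_sum (@complex.Re R : {additive C -> R})).
rewrite ReS; congr complex.Re.
under [RHS]eq_bigr do rewrite mulr_sumr.
rewrite [RHS]exchange_big; apply: eq_bigr => j _ /=.
under [RHS]eq_bigr do rewrite mulr_sumr.
rewrite [RHS]exchange_big; apply: eq_bigr => i _ /=.
under [RHS]eq_bigr do rewrite mulr_sumr.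
rewrite [RHS]exchange_big; apply: eq_bigr => j' _ /=.
under [RHS]eq_bigr do rewrite mulr_sumr.
rewrite [RHS]exchange_big; apply: eq_bigr => i' _ /=.
rewrite NM mulr_sumr mulr_suml; apply: eq_bigr => t _; ring.
Qed.

Lemma cptp_choi_fidelity (N : sop R I I) : (0 < #|I|)%N -> cptp N ->
  [/\ choi_fidelity N <= 1,
      diamond_norm (sop_sub N (unitary_channel U)) <=
        2 * #|I|%:R * Num.sqrt (1 - choi_fidelity N) &
      2 * (1 - choi_fidelity N) <= diamond_norm (sop_sub N (unitary_channel U))].
Proof.
move=> I0 [T [K [iK NK]]]; rewrite (choi_fidelity_kraus NK); split.
- exact: fidelity_le1.
- exact: diamond_norm_le.
- exact: infidelity_le_diamond.
Qed.

(** Dimension zero needs its own treatment because the fidelity divides by the dimension; here all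
    trace norms are empty sums. *)
Lemma diamond_norm_dim0 (Phi : sop R I I) : #|I| = 0%N -> diamond_norm Phi <= 0.
Proof.
move=> I0; have tr0 (X : op R (I * I)%type (I * I)%type) : trnorm X = 0.
  by rewrite /trnorm big1 // => -[i j]; have := fintype0 i I0.
apply: ge_sup => [|_ [Y _ <-]]; last by rewrite tr0.
by exists (trnorm (ext_id (Ref := I) Phi (fun _ _ => 0))), (fun _ _ => 0) => //=; rewrite tr0.
Qed.

Lemma mixture_error (T : finType) (p : T -> R) (N : sop R I I) (M : T -> sop R I I) (eps : R) :
  (forall t, 0 <= p t) -> \sum_t p t = 1 ->
  (forall X, opeq (N X) (fun i j => \sum_t creal (p t) * M t X i j)) ->
  cptp N -> (forall t, cptp (M t)) -> eps_correct N U eps ->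
  exists e : T -> R, [/\ forall t, 0 <= e t, forall t, eps_correct (M t) U (e t) &
    \sum_t p t * e t <= #|I|%:R * Num.sqrt (2 * eps)].
Proof.
move=> p0 p1 NM cN cM hN; have [I0|I0] := posnP #|I|.
  exists (fun _ => 0); split=> // [t|]; first exact: diamond_norm_dim0.
  by rewrite I0 mul0r big1 // => t _; rewrite mulr0.
have [_ _ fN] := cptp_choi_fidelity I0 cN.
have fM t := cptp_choi_fidelity I0 (cM t).
have d0 : 0 <= #|I|%:R :> R by exact: ler0n.
have f1 t : 0 <= 1 - choi_fidelity (M t) by rewrite subr_ge0; have [] := fM t.
(* The errors chosen are the fidelity estimates rather than the diamond norms, since fidelities
   average exactly over the mixture. *)
exists (fun t => 2 * #|I|%:R * Num.sqrt (1 - choi_fidelity (M t))); split=> [t|t|].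
- by rewrite !mulr_ge0 ?sqrtr_ge0.
- by have [_ + _] := fM t.
have -> : \sum_t p t * (2 * #|I|%:R * Num.sqrt (1 - choi_fidelity (M t))) =
    #|I|%:R * (2 * \sum_t p t * Num.sqrt (1 - choi_fidelity (M t))).
  by rewrite !mulr_sumr; apply: eq_bigr => t _; ring.
apply: ler_wpM2l => //.
have := sum_sqrt_le p0 f1 p1.
have -> : \sum_t p t * (1 - choi_fidelity (M t)) = 1 - choi_fidelity N.
  rewrite (choi_fidelity_mixture NM) -[1 in RHS]p1 -sumrB; apply: eq_bigr => t _; ring.
have fe : 1 - choi_fidelity N <= eps / 2 by have := le_trans fN hN; lra.
move=> /le_trans/(_ (ler_wsqrtr fe)) h.
apply: le_trans (ler_wpM2l _ h) _; first lra.
(* The factor 2 goes under the root: [2 sqrt (eps / 2) = sqrt (2 eps)]. *)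
have -> : 2 * eps = 2 ^+ 2 * (eps / 2) by field.
by rewrite [leRHS]sqrtrM ?sqr_ge0 // sqrtr_sqr ger0_norm.
Qed.

End ChannelFidelity.

(** * Averaging the pure-state bound over an arbitrary ensemble *)

Theorem mainTheorem8 (R : realType) (dA dB : nat)
  (U : op R ('I_dA * 'I_dB)%type ('I_dA * 'I_dB)%type) (F : R -> R) (lambda : R) :
  unitary U ->
  concave_on_nonneg F -> nondecr_on_nonneg F ->
  (forall (eps : R) (dL dR dKa dMa dKb dMb : nat)
     (V : seq (op R ('I_dKa * 'I_dMb)%type ('I_dA * 'I_dL)%type))
     (V' : seq (op R ('I_dMa * 'I_dKb)%type ('I_dR * 'I_dB)%type))
     (W : seq (op R 'I_dA ('I_dKa * 'I_dMa)%type))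
     (W' : seq (op R 'I_dB ('I_dKb * 'I_dMb)%type))
     (psi : ('I_dL * 'I_dR)%type -> R[i]),
     nlqc_valid V V' W W' -> unit_vec psi ->
     eps_correct (nlqc V V' W W' (proj psi)) U eps ->
     lambda - F eps <= vn_entropy (ptrace1 (proj psi))) ->
  forall (eps : R) (dL dR dKa dMa dKb dMb : nat)
     (V : seq (op R ('I_dKa * 'I_dMb)%type ('I_dA * 'I_dL)%type))
     (V' : seq (op R ('I_dMa * 'I_dKb)%type ('I_dR * 'I_dB)%type))
     (W : seq (op R 'I_dA ('I_dKa * 'I_dMa)%type))
     (W' : seq (op R 'I_dB ('I_dKb * 'I_dMb)%type))
     (Psi : op R ('I_dL * 'I_dR)%type ('I_dL * 'I_dR)%type),
     nlqc_valid V V' W W' -> density Psi ->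
     eps_correct (nlqc V V' W W' Psi) U eps ->
     lambda - F ((dA * dB)%:R * Num.sqrt (2 * eps)) <= ent_formation Psi.
Proof.
move=> uU cF mF pure_bound eps dL dR dKa dMa dKb dMb V V' W W' Psi hV dPsi hN.
(* A lower bound of the set bounds [inf] only if the set is nonempty, so the spectral ensemble is
   supplied first; then every ensemble is treated. *)
apply: lb_le_inf => [|_ [n [p [psi [ens ->]]]]].
  have [n [p [psi ens]]] := density_ensemble dPsi.
  by exists (\sum_k p k * vn_entropy (ptrace1 (proj (psi k)))), n, p, psi.
have [p0 p1 psi1 _] := ens.
have [e [e0 he be]] := mixture_error uU p0 p1
  (fun X => nlqc_mixture X hV ens) (cptp_nlqc hV ens)
  (fun k => cptp_nlqc hV (ensemble_proj (psi1 k))) hN.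
rewrite card_prod !card_ord in be.
have Fe : \sum_k p k * F (e k) <= F ((dA * dB)%:R * Num.sqrt (2 * eps)).
  apply: le_trans (concave_jensen cF p0 e0 p1) _.
  by apply: mF => //; apply: sumr_ge0 => k _; rewrite mulr_ge0.
apply: (@le_trans _ _ (\sum_k p k * (lambda - F (e k)))).
  under eq_bigr do rewrite mulrBr.
  by rewrite sumrB -mulr_suml p1 mul1r lerD2l lerN2.
by apply: ler_sum => k _; rewrite ler_wpM2l //; exact: pure_bound (he k).
Qed.
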